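(* Let $\mathcal F=\{f_1,\dots,f_m\}$ be vectors in $\mathbb R^N$, and let $l$ and $n$ be positive integers with $l<m$ and $n<N$. Then there exists a bundle $\mathbf V_0=\{V_1^0,\dots,V_l^0\}\in\mathfrak B$ such that $$e(\mathcal F,\mathbf V_0)=\sum_{i=1}^m\min_{1\le j\le l}d_2^2(f_i,V_j^0)=\inf\{e(\mathcal F,\mathbf V):\mathbf V\in\mathfrak B\}.$$
   Context: $\mathfrak B=\mathfrak B(l)$ is the set of all sequences (bundles) $\{V_1,\dots,V_l\}$ of length $l$ in which each $V_i$ is a linear subspace of $\mathbb R^N$ of dimension at most $n$ (repetitions and the zero subspace allowed). $d_2$ is the Euclidean distance, $d_2(f,V)=\inf_{v\in V}\|f-v\|_2$, and for $\mathbf V=\{V_1,\dots,V_l\}\in\mathfrak B$, $e(\mathcal F,\mathbf V)=\sum_{i=1}^m\min_{1\le j\le l}d_2^2(f_i,V_j)$. *)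

(* Defs.v *)
From HB Require Import structures.
From mathcomp Require Import all_boot all_order all_algebra.
From mathcomp Require Import all_classical all_reals.

Set Implicit Arguments.
Unset Strict Implicit.
Unset Printing Implicit Defensive.

Import Order.TTheory GRing.Theory Num.Theory.
Local Open Scope classical_set_scope.
Local Open Scope ring_scope.

Definition norm2 (R : realType) (N : nat) (x : 'rV[R]_N) : R :=
  Num.sqrt (\sum_(k < N) x 0 k ^+ 2).

Definition d2 (R : realType) (N : nat) (f : 'rV[R]_N)
    (V : {vspace 'rV[R]_N}) : R :=
  inf [set norm2 (f - v) | v in [set v | v \in V]].

Definition bundles (R : realType) (N n l : nat) :
    set ('I_l -> {vspace 'rV[R]_N}) :=
  [set V | forall j, (\dim (V j) <= n)%N].

(* [Num.min] has no neutral element in [R]: the iterated minimum starts from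
   the value at the first index, so that it is the minimum over ['I_l]. *)
Definition bundle_error (R : realType) (N m l : nat) (l_gt0 : (0 < l)%N)
    (f : 'I_m -> 'rV[R]_N) (V : 'I_l -> {vspace 'rV[R]_N}) : R :=
  \sum_(i < m) \big[Num.min/d2 (f i) (V (Ordinal l_gt0)) ^+ 2]_(j < l)
    d2 (f i) (V j) ^+ 2.

(* Main.v *)
(** Instead of minimising over bundles, minimise the squared distance from the
matrix with rows [f i] to the matrices [G] whose rows can be assigned to the
indices [j < l] so that, for each [j], the rows assigned to [j] lie in some
subspace of dimension at most [n], i.e. form a matrix of rank at most [n].
For a fixed assignment this is the vanishing of all minors of size [n + 1], and
there are finitely many assignments, so such [G] form a closed set and the
minimum is attained.  The subspaces containing the rows of a minimiser form an
optimal bundle: for any bundle [V], the points of [V] almost nearest to the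
[f i] are the rows of an admissible [G] whose cost is almost the error of
[V]. *)

Require Import Defs.
From HB Require Import structures.
From mathcomp Require Import all_boot all_order all_algebra.
From mathcomp Require Import all_classical all_reals.
From mathcomp Require Import topology normedtype derive.

Import Order.TTheory GRing.Theory Num.Theory.
Import numFieldNormedType.Exports.
Local Open Scope classical_set_scope.
Local Open Scope ring_scope.

(** * Rank, minors and row spaces *)

Lemma mxrank_mxsub {F : fieldType} {m n p q : nat} (A : 'M[F]_(m, n))
    (g : 'I_p -> 'I_m) (h : 'I_q -> 'I_n) :
  (\rank (mxsub g h A) <= \rank A)%N.
Proof.
have -> : mxsub g h A = rowsub g 1%:M *m A *m colsub h 1%:M.
  by rewrite mul_rowsub_mx mul1mx mulmx_colsub mulmx1 -mxsub_comp.
exact: leq_trans (mxrankM_maxl _ _) (mxrankM_maxr _ _).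
Qed.

Lemma row_free_rowsub {F : fieldType} {m n p : nat} (A : 'M[F]_(m, n))
    (g : 'I_p -> 'I_m) :
  injective g -> row_free A -> row_free (rowsub g A).
Proof.
move=> g_inj /row_freeP[B AB1]; apply/row_freeP; exists (colsub g B).
rewrite mulmx_colsub mul_rowsub_mx AB1 -mxsub_comp.
by apply/matrixP => i j; rewrite !mxE /= (inj_eq g_inj).
Qed.

(** If the rank exceeds [r], choosing [r.+1] independent rows and then [r.+1] independent columns of
    the result gives a nonzero minor. Selections with repetitions are harmless, since their minors
    vanish. *)
Lemma mxrank_le_minors {F : fieldType} {m n : nat} (r : nat)
    (A : 'M[F]_(m, n)) :
  (\rank A <= r)%N <->
  forall (g : 'I_r.+1 -> 'I_m) (h : 'I_r.+1 -> 'I_n), \det (mxsub g h A) = 0.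
Proof.
split=> [rkA g h|minors0].
  apply/eqP; rewrite -[_ == 0]negbK -unitfE -[_ \is a _]/(_ \in unitmx).
  rewrite -row_free_unit /row_free neq_ltn.
  by rewrite ltnS (leq_trans (mxrank_mxsub _ _ _) rkA).
rewrite leqNgt; apply/negP => rkA.
pose g := maxrankfun A \o widen_ord rkA.
have g_free : row_free (rowsub g A).
  rewrite rowsub_comp; apply: row_free_rowsub; last exact: maxrowsub_free.
  by move=> i j /(congr1 val) /= ij; apply: val_inj.
have gT_full : row_full (rowsub g A)^T by rewrite /row_full mxrank_tr.
move: (fullrowsub_unit gT_full); set h := fullrankfun _ => h_unit.
have : mxsub g h A \in unitmx.
  by move: h_unit; rewrite -[in X in _ -> X]unitmx_tr !trmx_mxsub -mxsub_comp.
by rewrite unitmxE minors0 unitr0.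
Qed.

Lemma mxrank_le_vspace {F : fieldType} {m n : nat} (r : nat)
    (A : 'M[F]_(m, n)) :
  (\rank A <= r)%N <->
  exists2 V : {vspace 'rV[F]_n}, (\dim V <= r)%N & forall i, row i A \in V.
Proof.
split=> [rkA|[V dimV rowA]].
  pose X := [seq row k (row_base A) | k : 'I_(\rank A)].
  exists <<X>>%VS.
    by apply: leq_trans (dim_span _) _; rewrite size_map -cardE card_ord.
  move=> i; rewrite -(mulmx_base A) row_mul mulmx_sum_row.
  apply: memv_suml => k _; apply: memvZ; apply: memv_span.
  by apply: map_f; rewrite mem_enum.
(* Coordinates of the rows in a basis of [V] factor [A] through dimension [\dim V]. *)
pose B := \matrix_(k < \dim V) (vbasis V)`_k.
pose C := \matrix_(i < m, k < \dim V) coord (vbasis V) k (row i A).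
suff -> : A = C *m B.
  by apply: leq_trans (mxrankM_maxr _ _) _; apply: leq_trans (rank_leq_row _) _.
apply/row_matrixP => i; rewrite row_mul mulmx_sum_row.
rewrite [LHS](coord_vbasis (rowA i)).
by apply: eq_bigr => k _; rewrite rowK !mxE.
Qed.

(** * Squared distance to a subspace *)

Section SquaredDistance.
Context {R : realType} {N : nat}.
Implicit Types (x f v : 'rV[R]_N) (V : {vspace 'rV[R]_N}).

Definition sqnorm x : R := \sum_(k < N) x 0 k ^+ 2.

Lemma sqnorm_ge0 x : 0 <= sqnorm x.
Proof. by apply: sumr_ge0 => k _; exact: sqr_ge0. Qed.

Let dist_set f V := [set norm2 (f - v) | v in [set v | v \in V]].

Let dist_set_lb0 f V : lbound (dist_set f V) 0.
Proof. by move=> _ [v _ <-]; exact: sqrtr_ge0. Qed.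

Let dist_set_neq0 f V : dist_set f V !=set0.
Proof. by exists (norm2 (f - 0)), 0 => //=; exact: mem0v. Qed.

Lemma d2_ge0 f V : 0 <= d2 f V.
Proof. exact: lb_le_inf (dist_set_neq0 f V) (dist_set_lb0 f V). Qed.

Lemma sqr_d2_le f V v : v \in V -> d2 f V ^+ 2 <= sqnorm (f - v).
Proof.
move=> vV; rewrite -(sqr_sqrtr (sqnorm_ge0 _)).
rewrite ler_pXn2r ?nnegrE ?d2_ge0 ?sqrtr_ge0 //.
by apply: ge_inf; [exists 0; exact: dist_set_lb0 | exists v].
Qed.

(** Almost nearest points suffice later, so the infimum in [d2] need not be shown to be attained. *)
Lemma sqr_d2_adherent f V (e : R) : 0 < e ->
  exists2 v, v \in V & sqnorm (f - v) < d2 f V ^+ 2 + e.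
Proof.
move=> e0.
have lt_d : inf (dist_set f V) < Num.sqrt (d2 f V ^+ 2 + e).
  rewrite -[ltLHS]/(d2 f V) -{1}(ger0_norm (d2_ge0 f V)) -sqrtr_sqr.
  by rewrite ltr_sqrt ?ltrDl // ltr_wpDl ?sqr_ge0.
have [_ [v vV <-] ltv] := inf_lt (dist_set_neq0 f V) lt_d.
exists v => //; move: ltv; rewrite /norm2 ltr_sqrt //.
by rewrite ltr_wpDl ?sqr_ge0.
Qed.

End SquaredDistance.

(** * Nearest points of closed sets *)

Lemma closed_nearest_point {R : realType} {p : nat} (K : set 'rV[R]_p)
    (a : 'rV[R]_p) :
  closed K -> K !=set0 ->
  exists2 c, K c & forall u, K u -> sqnorm (a - c) <= sqnorm (a - u).
Proof.
move=> Kcl [u0 Ku0].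
have cont : continuous (fun u : 'rV[R]_p => sqnorm (a - u)).
  apply: continuous_big => [|k _]; first exact: add_continuous.
  have contk : continuous (fun x : 'rV[R]_p => a 0 k - x 0 k).
    move=> u; apply: continuousB; first exact: cst_continuous.
    exact: coord_continuous.
  move=> u; under eq_fun do rewrite !mxE expr2.
  exact: (continuousM (contk u) (contk u)).
(* [K] may be unbounded; cutting it by the ball around [a] through [u0] makes it compact and loses
   no minimiser. *)
pose L := K `&` [set u | sqnorm (a - u) <= sqnorm (a - u0)].
have Lcl : closed L.
  apply: closedI => //.
  exact: (preimage_closed (fun u _ => cont u) (@closed_le R _)).
have Lbd : bounded_set L.
  (* The norm here is the sup norm, which the Euclidean norm dominates. *)
  exists (`|a| + Num.sqrt (sqnorm (a - u0))); split; first exact: num_real.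
  move=> M ltM u [_ /= leu]; apply: le_trans (ltW ltM).
  rewrite -[u](subKr a) (le_trans (ler_normB _ _)) // lerD2l.
  rewrite [leLHS]mx_normrE bigmax_le ?sqrtr_ge0 // => -[i k] _ /=.
  rewrite ord1 -sqrtr_sqr ler_wsqrtr // (le_trans _ leu) //.
  rewrite /sqnorm (bigD1 k) //= lerDl.
  by apply: sumr_ge0 => ? _; exact: sqr_ge0.
have L0 : L !=set0 by exists u0; split => //=.
have [c /set_mem[Kc lec] cmin] := EVT_min_rV L0 (bounded_closed_compact Lbd Lcl)
  (continuous_subspaceT cont).
exists c => // u Ku.
have [leu|/ltW leu] := leP (sqnorm (a - u)) (sqnorm (a - u0)).
  by apply: cmin; apply/mem_set; split.
exact: le_trans lec leu.
Qed.

Lemma continuous_det {R : realType} {T : topologicalType} {r : nat}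
    (A : T -> 'M[R]_r) :
  (forall i j, continuous (fun t => A t i j)) ->
  continuous (fun t => \det (A t)).
Proof.
move=> Acont; apply: continuous_big => [|s _]; first exact: add_continuous.
move=> t; apply: cvgM; first exact: cvg_cst.
move: t; apply: continuous_big => [|i _].
  exact: mul_continuous.
exact: Acont.
Qed.

(** * Matrices fitted by a bundle *)

Section FittingMatrices.
Context {R : realType}.
Variables (m N l n : nat).

Definition bundle_fits (G : 'M[R]_(m, N)) (s : 'I_m -> 'I_l)
    (V : 'I_l -> {vspace 'rV[R]_N}) :=
  bundles n V /\ forall i, row i G \in V (s i).

(** Rows not assigned to [j] are replaced by zero, which lies in every subspace, so the size of the
    block does not depend on [s]. *)
Definition row_block (G : 'M[R]_(m, N)) (s : 'I_m -> 'I_l) (j : 'I_l) :=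
  \matrix_(i < m) (if s i == j then row i G else 0).

Lemma bundle_fits_minors G s :
  (exists V, bundle_fits G s V) <->
  forall j (g : 'I_n.+1 -> 'I_m) (h : 'I_n.+1 -> 'I_N),
    \det (mxsub g h (row_block G s j)) = 0.
Proof.
split=> [[V [dimV rowV]] j|minors0].
  apply/mxrank_le_minors/mxrank_le_vspace; exists (V j); first exact: dimV.
  by move=> i; rewrite rowK; case: eqP => [<- //|_]; exact: mem0v.
have /choice[V VP] : forall j, exists V : {vspace 'rV[R]_N},
    (\dim V <= n)%N /\ forall i, row i (row_block G s j) \in V.
  move=> j; have /mxrank_le_minors/mxrank_le_vspace[V] := minors0 j.
  by exists V.
exists V; split=> [j|i]; first by have [] := VP j.
by have [_ /(_ i)] := VP (s i); rewrite rowK eqxx.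
Qed.

(** A finite union, over the assignments [s], of common zero sets of minors, which are continuous in
    the entries. Matrices are flattened to match [closed_nearest_point]. *)
Lemma closed_bundle_fits :
  closed [set u : 'rV[R]_(m * N) |
    exists s : {ffun 'I_m -> 'I_l}, exists V, bundle_fits (vec_mx u) s V].
Proof.
rewrite (_ : mkset _ = \bigcup_(s in [set: {ffun 'I_m -> 'I_l}])
   \bigcap_j \bigcap_g \bigcap_h
   [set u | \det (mxsub (g : 'I_n.+1 -> 'I_m) (h : 'I_n.+1 -> 'I_N)
      (row_block (vec_mx u) s j)) = 0]); last first.
  apply/seteqP; split=> u /=.
    by move=> [s /bundle_fits_minors P]; exists s => // j _ g _ h _; exact: P.
  move=> [s _ P]; exists s; apply/bundle_fits_minors => j g h.
  exact: (P j I g I h I).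
apply: closed_bigcup => [|s _]; first exact: finite_finset.
apply: closed_bigI => j _; apply: closed_bigI => g _; apply: closed_bigI => h _.
apply: (preimage_closed _ (@closed_eq R 0)) => u _.
move: u; apply: continuous_det => i k.
rewrite (_ : (fun _ => _) = fun u : 'rV[R]_(m * N) =>
    if s (g i) == j then u 0 (mxvec_index (g i) (h k)) else 0).
  by case: (_ == j); [exact: coord_continuous | exact: cst_continuous].
by apply/funext => u; rewrite !mxE; case: ifP => _; rewrite !mxE.
Qed.

End FittingMatrices.

(** * Bundle error against matrix distance *)

Lemma bundle_error_le {R : realType} {N m l n : nat} (l_gt0 : (0 < l)%N)
    (f : 'I_m -> 'rV[R]_N) (G : 'M[R]_(m, N)) s V :
  bundle_fits m N l n G s V ->
  bundle_error l_gt0 f V <= \sum_(i < m) sqnorm (f i - row i G).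
Proof.
move=> [_ GV]; apply: ler_sum => i _.
by apply: le_trans (sqr_d2_le _ _ _ (GV i)); exact: bigmin_le.
Qed.

Lemma bundle_error_adherent {R : realType} {N m l n : nat} (l_gt0 : (0 < l)%N)
    (f : 'I_m -> 'rV[R]_N) V (e : R) :
  bundles n V -> 0 < e ->
  exists (s : {ffun 'I_m -> 'I_l}) (G : 'M[R]_(m, N)),
    bundle_fits m N l n G s V /\
    \sum_(i < m) sqnorm (f i - row i G) <= bundle_error l_gt0 f V + m%:R * e.
Proof.
move=> dimV e0.
pose best i := \big[Num.min/d2 (f i) (V (Ordinal l_gt0)) ^+ 2]_(j < l)
  d2 (f i) (V j) ^+ 2.
have /choice[s sE] : forall i, exists j, best i = d2 (f i) (V j) ^+ 2.
  (* Being one of the values [d2 (f i) (V j) ^+ 2] holds for the starting value and is preserved by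
     [Num.min]. *)
  move=> i; apply: (big_ind (fun x => exists j, x = d2 (f i) (V j) ^+ 2)).
  - by exists (Ordinal l_gt0).
  - by move=> _ _ [j ->] [k ->]; case: leP => _; [exists j | exists k].
  - by move=> j _; exists j.
have /choice[v vP] : forall i, exists v,
    v \in V (s i) /\ sqnorm (f i - v) < best i + e.
  move=> i; rewrite sE.
  by have [v] := sqr_d2_adherent (f i) (V (s i)) e e0; exists v.
exists (finfun s), (\matrix_i v i); split.
  by split=> // i; rewrite rowK ffunE; have [] := vP i.
have -> : m%:R * e = \sum_(i < m) e by rewrite sumr_const card_ord mulr_natl.
rewrite /bundle_error -big_split /=.
by apply: ler_sum => i _; rewrite rowK; apply: ltW; have [] := vP i.
Qed.

Theorem theorem4p2 (R : realType) (N m l n : nat) (f : 'I_m -> 'rV[R]_N)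
    (l_gt0 : (0 < l)%N) (n_gt0 : (0 < n)%N)
    (l_lt_m : (l < m)%N) (n_lt_N : (n < N)%N) :
  exists2 V0 : 'I_l -> {vspace 'rV[R]_N},
    bundles n V0 &
    bundle_error l_gt0 f V0 =
      inf [set bundle_error l_gt0 f V | V in @bundles R N n l].
Proof.
pose F : 'M[R]_(m, N) := \matrix_i f i.
have sqnormF (G : 'M[R]_(m, N)) :
    \sum_(i < m) sqnorm (f i - row i G) = sqnorm (mxvec F - mxvec G).
  rewrite /sqnorm pair_bigA /=.
  rewrite (reindex _ (curry_mxvec_bij m N)) /=.
  apply: eq_bigr => -[i k] _ /=.
  by rewrite [in RHS]mxE [in RHS]mxE !mxvecE !mxE.
have [|c [s [V0 fit0]] cmin] :=
    closed_nearest_point _ (mxvec F) (@closed_bundle_fits R m N l n).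
  (* The zero matrix, fitted by zero subspaces, shows that the closed set is nonempty. *)
  exists 0, [ffun=> Ordinal l_gt0], (fun=> 0%VS); split=> [j|i] /=.
    by rewrite dimv0.
  by rewrite linear0 row0 mem0v.
exists V0; first by case: fit0.
have V0min V : bundles n V -> bundle_error l_gt0 f V0 <= bundle_error l_gt0 f V.
  move=> dimV; apply: le_trans (bundle_error_le l_gt0 f _ _ _ fit0) _.
  rewrite sqnormF vec_mxK; apply/ler_addgt0Pr => e e0.
  (* A slack of [e / m%:R] in each of the [m] rows adds up to [e]. *)
  have m_gt0 : 0 < m%:R :> R by rewrite ltr0n (leq_ltn_trans _ l_lt_m).
  have [t [G [fitG]]] := bundle_error_adherent l_gt0 f V (e / m%:R) dimV
    (divr_gt0 e0 m_gt0).
  rewrite mulrC divfK ?gt_eqF // sqnormF; apply: le_trans; apply: cmin.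
  by exists t, V; rewrite mxvecK.
apply/le_anti/andP; split.
  apply: lb_le_inf => [|_ [V dimV <-]]; last exact: V0min.
  by exists (bundle_error l_gt0 f V0), V0 => //; case: fit0.
apply: ge_inf; last by exists V0 => //; case: fit0.
by exists (bundle_error l_gt0 f V0) => _ [V dimV <-]; exact: V0min.
Qed.
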